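(* Let $\mathcal C$ be a spherical fusion category with spherical dimension function $d$, let $I\colon\mathcal C\to Z(\mathcal C)$ be the adjoint of the forgetful functor, and let $\{e_X\}_{X\in\mathrm{Irr}(\mathcal C)}\subseteq\mathrm{End}_{Z(\mathcal C)}(I(\mathbb 1))$ be the elements described in the context. Then for all $Y,Z\in\mathrm{Irr}(\mathcal C)$, $$e_Y\circ e_Z=\sum_{X\in\mathrm{Irr}(\mathcal C)}\frac{d_Yd_Z}{d_X}\,N^X_{YZ}\,e_X .$$
   Context: Fusion categories are over $\mathbb C$. $\mathrm{Irr}(\mathcal C)$ is a set of representatives of simple objects, $d_X$ the spherical (categorical) dimension, $N^X_{YZ}=\dim_{\mathbb C}\mathcal C(Y\otimes Z,X)$. Objects of the Drinfeld center $Z(\mathcal C)$ are pairs $(Y,\phi_Y)$ with half-braiding $\phi_{Y,W}\colon Y\otimes W\to W\otimes Y$. Fix square roots $\sqrt{d_X}$ for $X\in\mathrm{Irr}(\mathcal C)$. The object $I(\mathbb 1)=\bigoplus_{X\in\mathrm{Irr}(\mathcal C)}X\otimes\bar X$ has the half-braiding with $W$ whose component $Y\otimes\bar Y\otimes W\to W\otimes Z\otimes\bar Z$ is $\sqrt{d_Y}\sqrt{d_Z}\sum_i i\otimes i^\bullet$, where $\{i\}$ is a basis of $\mathcal C(Y,W\otimes Z)$ and $\{i^\bullet\}\subseteq\mathcal C(\bar Y\otimes W,\bar Z)$ the dual basis for the pairing $\mathrm{ev}_{\bar Z\otimes Z}\circ(j^\bullet\otimes 1_Z)\circ(1_{\bar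 Y}\otimes i)\circ\mathrm{coev}_{\bar Y\otimes Y}=\delta_{i,j}$. Here evaluations and coevaluations are those of the spherical structure. For $Y\in\mathrm{Irr}(\mathcal C)$, $e_Y\in\mathrm{End}_{Z(\mathcal C)}(I(\mathbb 1))$ is the morphism whose component $X\otimes\bar X\to Z\otimes\bar Z$ (for $X,Z\in\mathrm{Irr}(\mathcal C)$) is $$d_Y\sqrt{d_X}\sqrt{d_Z}\sum_i(1_Z\otimes i)\circ(i^\bullet\otimes1_{\bar X}),$$ where $\{i\}$ is a basis of $\mathcal C(Y\otimes\bar X,\bar Z)$ and $\{i^\bullet\}\subseteq\mathcal C(X,Z\otimes Y)$ the dual basis for the pairing $\mathrm{ev}_{Z\otimes\bar Z}\circ(1_Z\otimes i)\circ(j^\bullet\otimes1_{\bar X})\circ\mathrm{coev}_{X\otimes\bar X}=\delta_{i,j}$. *)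

(* Defs.v *)
From HB Require Import structures.
From mathcomp Require Import all_boot all_order all_algebra.
From mathcomp Require Import all_classical all_reals.
From mathcomp Require Export complex.

Set Implicit Arguments.
Unset Strict Implicit.
Unset Printing Implicit Defensive.

Import Order.TTheory GRing.Theory Num.Theory.
Local Open Scope ring_scope.

Declare Scope cat_scope.
Delimit Scope cat_scope with cat.
Local Open Scope cat_scope.

Record category := Category {
  obj :> Type;
  mor : obj -> obj -> Type;
  mid : forall X, mor X X;
  mcomp : forall X Y Z, mor Y Z -> mor X Y -> mor X Z;
  _ : forall X Y (f : mor X Y), mcomp (mid Y) f = f;
  _ : forall X Y (f : mor X Y), mcomp f (mid X) = f;
  _ : forall X Y Z T (h : mor Z T) (g : mor Y Z) (f : mor X Y),
      mcomp h (mcomp g f) = mcomp (mcomp h g) f }.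

Record functor (A B : category) := Functor {
  fobj :> A -> B;
  fmap : forall X Y, mor X Y -> mor (fobj X) (fobj Y);
  _ : forall X, fmap (mid X) = mid (fobj X);
  _ : forall X Y Z (g : mor Y Z) (f : mor X Y),
      fmap (mcomp g f) = mcomp (fmap g) (fmap f) }.

(* F is left adjoint to G *)
Definition adjoint (A B : category) (F : functor A B) (G : functor B A) :=
  exists Phi : forall X Y, mor (F X) Y -> mor X (G Y),
    [/\ forall X Y, bijective (@Phi X Y),
        forall X Y Y' (g : mor Y Y') (f : mor (F X) Y),
          Phi X Y' (mcomp g f) = mcomp (fmap G g) (Phi X Y f)
      & forall X X' Y (f : mor (F X) Y) (h : mor X' X),
          Phi X' Y (mcomp f (fmap F h)) = mcomp (Phi X Y f) h].

Record lincat (K : fieldType) := LinCat {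
  ob :> Type;
  hom : ob -> ob -> vectType K;
  idm : forall X, hom X X;
  comp : forall X Y Z, hom Y Z -> hom X Y -> hom X Z;
  comp1m : forall X Y (f : hom X Y), comp (idm Y) f = f;
  compm1 : forall X Y (f : hom X Y), comp f (idm X) = f;
  compA : forall X Y Z T (h : hom Z T) (g : hom Y Z) (f : hom X Y),
      comp h (comp g f) = comp (comp h g) f;
  comp_linear_l : forall X Y Z (f : hom X Y), linear (fun g : hom Y Z => comp g f);
  comp_linear_r : forall X Y Z (g : hom Y Z), linear (fun f : hom X Y => comp g f) }.

Arguments idm {K l} X.

Notation "g ∘ f" := (comp g f) (at level 40, left associativity) : cat_scope.

Definition base_category (K : fieldType) (C : lincat K) : category :=
  @Category C (fun X Y => hom X Y : Type) (@idm K C) (@comp K C)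
    (@comp1m K C) (@compm1 K C) (@compA K C).

Section Abelian.
Variables (K : fieldType) (C : lincat K).
Implicit Types X Y Z T N S : C.

Definition iso X Y (f : hom X Y) := exists g : hom Y X, g ∘ f = idm X /\ f ∘ g = idm Y.
Definition isomorphic X Y := exists f : hom X Y, iso f.

Definition zero_object Z := forall X, (forall f : hom X Z, f = 0) /\ (forall f : hom Z X, f = 0).

Record biproduct (I : finType) (F : I -> C) (B : C) := Biproduct {
  bp_inj : forall i, hom (F i) B;
  bp_proj : forall i, hom B (F i);
  bp_projK : forall i, bp_proj i ∘ bp_inj i = idm (F i);
  bp_proj_inj0 : forall i j, i != j -> bp_proj j ∘ bp_inj i = 0;
  bp_sum : \sum_i bp_inj i ∘ bp_proj i = idm B }.

Definition mono X Y (m : hom X Y) := forall T (u v : hom T X), m ∘ u = m ∘ v -> u = v.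
Definition epi X Y (e : hom X Y) := forall T (u v : hom Y T), u ∘ e = v ∘ e -> u = v.

Definition is_kernel N X Y (f : hom X Y) (k : hom N X) :=
  f ∘ k = 0 /\ forall T (t : hom T X), f ∘ t = 0 -> exists! u : hom T N, k ∘ u = t.
Definition is_cokernel X Y N (f : hom X Y) (c : hom Y N) :=
  c ∘ f = 0 /\ forall T (t : hom Y T), t ∘ f = 0 -> exists! u : hom N T, u ∘ c = t.

Record abelian : Prop := Abelian {
  has_direct_sums : forall n (F : 'I_n -> C), exists B, inhabited (biproduct F B);
  has_kernels : forall X Y (f : hom X Y), exists N (k : hom N X), is_kernel f k;
  has_cokernels : forall X Y (f : hom X Y), exists N (c : hom Y N), is_cokernel f c;
  mono_normal : forall X Y (m : hom X Y), mono m -> exists Z (f : hom Y Z), is_kernel f m;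
  epi_normal : forall X Y (e : hom X Y), epi e -> exists Z (f : hom Z X), is_cokernel f e }.

Definition simple X :=
  ~ zero_object X /\ forall S (m : hom S X), mono m -> zero_object S \/ iso m.

Definition semisimple :=
  forall X, exists n (F : 'I_n -> C), (forall i, simple (F i)) /\ inhabited (biproduct F X).

Record simple_representatives (I : Type) (S : I -> C) : Prop := SimpleRepresentatives {
  repr_simple : forall i, simple (S i);
  repr_surj : forall X, simple X -> exists i, isomorphic X (S i);
  repr_inj : forall i j, isomorphic (S i) (S j) -> i = j }.

End Abelian.

Record moncat (K : fieldType) := MonCat {
  mon_lincat :> lincat K;
  tunit : mon_lincat;
  tens : mon_lincat -> mon_lincat -> mon_lincat;
  tensm : forall X Y X' Y', hom X X' -> hom Y Y' -> hom (tens X Y) (tens X' Y');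
  assoc : forall X Y Z, hom (tens (tens X Y) Z) (tens X (tens Y Z));
  assoc_inv : forall X Y Z, hom (tens X (tens Y Z)) (tens (tens X Y) Z);
  lunit : forall X, hom (tens tunit X) X;
  lunit_inv : forall X, hom X (tens tunit X);
  runit : forall X, hom (tens X tunit) X;
  runit_inv : forall X, hom X (tens X tunit);
  tensm_id : forall X Y, tensm (idm X) (idm Y) = idm (tens X Y);
  tensm_comp : forall X X' X'' Y Y' Y'' (f' : hom X' X'') (f : hom X X')
      (g' : hom Y' Y'') (g : hom Y Y'),
      tensm (f' ∘ f) (g' ∘ g) = tensm f' g' ∘ tensm f g;
  tensm_linear_l : forall X X' Y Y' (g : hom Y Y'), linear (fun f : hom X X' => tensm f g);
  tensm_linear_r : forall X X' Y Y' (f : hom X X'), linear (fun g : hom Y Y' => tensm f g);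
  assocK : forall X Y Z, assoc_inv X Y Z ∘ assoc X Y Z = idm _;
  assocVK : forall X Y Z, assoc X Y Z ∘ assoc_inv X Y Z = idm _;
  lunitK : forall X, lunit_inv X ∘ lunit X = idm _;
  lunitVK : forall X, lunit X ∘ lunit_inv X = idm _;
  runitK : forall X, runit_inv X ∘ runit X = idm _;
  runitVK : forall X, runit X ∘ runit_inv X = idm _;
  assoc_nat : forall X X' Y Y' Z Z' (f : hom X X') (g : hom Y Y') (h : hom Z Z'),
      assoc X' Y' Z' ∘ tensm (tensm f g) h = tensm f (tensm g h) ∘ assoc X Y Z;
  lunit_nat : forall X X' (f : hom X X'), lunit X' ∘ tensm (idm tunit) f = f ∘ lunit X;
  runit_nat : forall X X' (f : hom X X'), runit X' ∘ tensm f (idm tunit) = f ∘ runit X;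
  pentagon : forall X Y Z T,
      assoc X Y (tens Z T) ∘ assoc (tens X Y) Z T
      = tensm (idm X) (assoc Y Z T) ∘ assoc X (tens Y Z) T ∘ tensm (assoc X Y Z) (idm T);
  triangle : forall X Y,
      tensm (idm X) (lunit Y) ∘ assoc X tunit Y = tensm (runit X) (idm Y) }.

Arguments tunit {K} m.
Arguments assoc {K m} X Y Z.
Arguments assoc_inv {K m} X Y Z.
Arguments lunit {K m} X.
Arguments lunit_inv {K m} X.
Arguments runit {K m} X.
Arguments runit_inv {K m} X.

Notation "X ⊗ Y" := (tens X Y) (at level 35, right associativity) : cat_scope.
Notation "f ⊗ₘ g" := (tensm f g) (at level 35, right associativity) : cat_scope.

(* Invertibility and the hexagon force the half-braiding with the unit object
   to be the canonical isomorphism, so this is not an axiom. *)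
Record center_obj (K : fieldType) (C : moncat K) := CenterObj {
  center_ob :> C;
  hb : forall W : C, hom (center_ob ⊗ W) (W ⊗ center_ob);
  hb_iso : forall W, iso (hb W);
  hb_nat : forall W W' (f : hom W W'),
      hb W' ∘ (idm center_ob ⊗ₘ f) = (f ⊗ₘ idm center_ob) ∘ hb W;
  hb_tens : forall W V,
      hb (W ⊗ V) = assoc_inv W V center_ob ∘ (idm W ⊗ₘ hb V) ∘ assoc W center_ob V
                   ∘ (hb W ⊗ₘ idm V) ∘ assoc_inv center_ob W V }.

Section Center.
Variables (K : fieldType) (C : moncat K).
Implicit Types A B D : center_obj C.

Definition central A B : {pred hom A B} :=
  fun f => `[< forall W : C, (idm W ⊗ₘ f) ∘ hb A W = hb B W ∘ (f ⊗ₘ idm W) >].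
Arguments central : clear implicits.

Record center_hom A B := CenterHom {
  center_val :> hom A B;
  _ : center_val \in central A B }.

HB.instance Definition _ A B := [isSub for @center_val A B].
HB.instance Definition _ A B := [Choice of center_hom A B by <:].

Lemma centralP A B (f : hom A B) :
  reflect (forall W : C, (idm W ⊗ₘ f) ∘ hb A W = hb B W ∘ (f ⊗ₘ idm W))
          (f \in central A B).
Proof. exact: asboolP. Qed.

Lemma central_submod A B : submod_closed (central A B).
Proof.
split=> [|a f g /centralP fP /centralP gP]; apply/centralP => W.
- have := tensm_linear_r (idm W) (-1) (0 : hom A B) 0.
  have := tensm_linear_l (idm W) (-1) (0 : hom A B) 0.
  rewrite /= !scaleN1r !addNr => -> ->.
  have := comp_linear_l (hb A W) (-1) (0 : hom (W ⊗ A) (W ⊗ B)) 0.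
  have := comp_linear_r (hb B W) (-1) (0 : hom (A ⊗ W) (B ⊗ W)) 0.
  by rewrite /= !scaleN1r !addNr => -> ->.
- rewrite (tensm_linear_r (idm W)) (tensm_linear_l (idm W)).
  by rewrite (comp_linear_l (hb A W)) (comp_linear_r (hb B W)) fP gP.
Qed.

HB.instance Definition _ A B :=
  GRing.isSubmodClosed.Build K (hom A B) (central A B) (central_submod A B).
HB.instance Definition _ A B :=
  [SubChoice_isSubLmodule of center_hom A B by <:].

Lemma central_id A : idm (center_ob A) \in central A A.
Proof. by apply/centralP => W; rewrite !tensm_id comp1m compm1. Qed.

Lemma central_comp A B D (g : center_hom B D) (f : center_hom A B) :
  center_val g ∘ center_val f \in central A D.
Proof.
case: g => g gP; case: f => f fP /=; apply/centralP => W.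
have -> : idm W ⊗ₘ (g ∘ f) = (idm W ⊗ₘ g) ∘ (idm W ⊗ₘ f) by rewrite -tensm_comp comp1m.
have -> : (g ∘ f) ⊗ₘ idm W = (g ⊗ₘ idm W) ∘ (f ⊗ₘ idm W) by rewrite -tensm_comp comp1m.
by rewrite -compA (centralP _ fP) !compA (centralP _ gP).
Qed.

Definition center_id A : center_hom A A := CenterHom (central_id A).
Definition center_comp A B D (g : center_hom B D) (f : center_hom A B) : center_hom A D :=
  CenterHom (central_comp g f).

Lemma center_val_inj A B : injective (@center_val A B).
Proof. exact: val_inj. Qed.

Lemma center_comp1m A B (f : center_hom A B) : center_comp (center_id B) f = f.
Proof. by apply: center_val_inj; rewrite /= comp1m. Qed.
Lemma center_compm1 A B (f : center_hom A B) : center_comp f (center_id A) = f.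
Proof. by apply: center_val_inj; rewrite /= compm1. Qed.
Lemma center_compA A B D E (h : center_hom D E) (g : center_hom B D) (f : center_hom A B) :
  center_comp h (center_comp g f) = center_comp (center_comp h g) f.
Proof. by apply: center_val_inj; rewrite /= compA. Qed.

Definition center : category :=
  @Category (center_obj C) center_hom center_id center_comp
    center_comp1m center_compm1 center_compA.

Definition forget : functor center (base_category C) :=
  @Functor center (base_category C) (@center_ob K C) (fun A B f => center_val f)
    (fun=> erefl) (fun _ _ _ _ _ => erefl).

End Center.

Section Dual.
Variables (K : fieldType) (C : moncat K).

(* D is a left dual of X *)
Definition is_dual (X D : C) (ev : hom (D ⊗ X) (tunit C)) (coev : hom (tunit C) (X ⊗ D)) :=
  runit X ∘ (idm X ⊗ₘ ev) ∘ assoc X D X ∘ (coev ⊗ₘ idm X) ∘ lunit_inv X = idm X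
  /\ lunit D ∘ (ev ⊗ₘ idm D) ∘ assoc_inv D X D ∘ (idm D ⊗ₘ coev) ∘ runit_inv D = idm D.

End Dual.

Record rigidcat (K : fieldType) := RigidCat {
  rigid_moncat :> moncat K;
  dual : rigid_moncat -> rigid_moncat;
  ev : forall X, hom (dual X ⊗ X) (tunit rigid_moncat);
  coev : forall X, hom (tunit rigid_moncat) (X ⊗ dual X);
  dualP : forall X, is_dual (ev X) (coev X);
  right_dual : forall X, exists D (e : hom (X ⊗ D) (tunit rigid_moncat))
      (c : hom (tunit rigid_moncat) (D ⊗ X)), is_dual e c }.

Arguments ev {K r} X.
Arguments coev {K r} X.

Record fusion (K : fieldType) (C : rigidcat K) : Prop := Fusion {
  fusion_abelian : abelian C;
  fusion_semisimple : semisimple C;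
  fusion_finite : exists n (S : 'I_n -> C), simple_representatives S;
  fusion_unit : simple (tunit C) }.

Section Mates.
Variables (K : fieldType) (C : rigidcat K).
Implicit Types X Y P Q : C.

Definition mate P Q (p : hom (P ⊗ Q) (tunit C)) : hom P (dual Q) :=
  lunit (dual Q) ∘ (p ⊗ₘ idm (dual Q)) ∘ assoc_inv P Q (dual Q)
  ∘ (idm P ⊗ₘ coev Q) ∘ runit_inv P.

Definition dualm X Y (f : hom X Y) : hom (dual Y) (dual X) :=
  mate (ev Y ∘ (idm (dual Y) ⊗ₘ f)).

Definition ev_tens X Y : hom ((dual Y ⊗ dual X) ⊗ (X ⊗ Y)) (tunit C) :=
  ev Y ∘ (idm (dual Y) ⊗ₘ
           (lunit Y ∘ (ev X ⊗ₘ idm Y) ∘ assoc_inv (dual X) X Y))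
  ∘ assoc (dual Y) (dual X) (X ⊗ Y).

Definition dual_tens X Y : hom (dual Y ⊗ dual X) (dual (X ⊗ Y)) := mate (ev_tens X Y).

End Mates.

(* A monoidal natural isomorphism from the identity to the double dual: both
   sides of [piv_tens] are morphisms from X ⊗ Y to the dual of dual Y ⊗ dual X,
   to which the double duals are compared by [dual_tens].  Compatibility with
   the unit object follows from the other axioms. *)
Record pivotal (K : fieldType) (C : rigidcat K) := Pivotal {
  piv : forall X : C, hom X (dual (dual X));
  piv_inv : forall X : C, hom (dual (dual X)) X;
  pivK : forall X, piv_inv X ∘ piv X = idm X;
  pivVK : forall X, piv X ∘ piv_inv X = idm (dual (dual X));
  piv_nat : forall X Y (f : hom X Y), piv Y ∘ f = dualm (dualm f) ∘ piv X;
  piv_tens : forall X Y,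
      dualm (dual_tens X Y) ∘ piv (X ⊗ Y)
      = dual_tens (dual Y) (dual X) ∘ (piv X ⊗ₘ piv Y) }.

Section Trace.
Variables (K : fieldType) (C : rigidcat K) (a : pivotal C).
Implicit Types X : C.

(* (co)evaluations exhibiting [dual X] as a right dual of X *)
Definition rev X : hom (X ⊗ dual X) (tunit C) :=
  ev (dual X) ∘ (piv a X ⊗ₘ idm (dual X)).
Definition rcoev X : hom (tunit C) (dual X ⊗ X) :=
  (idm (dual X) ⊗ₘ piv_inv a X) ∘ coev (dual X).

Definition trace_r X (f : hom X X) : hom (tunit C) (tunit C) :=
  rev X ∘ (f ⊗ₘ idm (dual X)) ∘ coev X.
Definition trace_l X (f : hom X X) : hom (tunit C) (tunit C) :=
  ev X ∘ (idm (dual X) ⊗ₘ f) ∘ rcoev X.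

Definition spherical := forall X (f : hom X X), trace_l f = trace_r f.

End Trace.

Record sphericalFusionCat (K : fieldType) := SphericalFusionCat {
  sph_cat :> rigidcat K;
  sph_fusion : fusion sph_cat;
  sph_piv : pivotal sph_cat;
  sph_spherical : spherical sph_piv }.

Definition induced_unit (K : fieldType) (C : moncat K)
  (I : functor (base_category C) (center C)) : center_obj C := I (tunit C).

Section Elements.
Variables (K : fieldType) (C : sphericalFusionCat K).
Implicit Types X Y Z W : C.

(* The endomorphisms of the unit object are the multiples of its identity;
   this is the coefficient. *)
Definition unit_coef (f : hom (tunit C) (tunit C)) : K :=
  coord [tuple idm (tunit C)] ord0 f.

Definition sdim X : K := unit_coef (trace_r (sph_piv C) (idm X)).

Definition fusion_coef X Y Z : nat := \dim {: hom (Y ⊗ Z) X}.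

(* b and b' are bases of V and V' dual to each other for a pairing with values
   in the endomorphisms of the unit object. *)
Definition dual_bases (V V' : vectType K) (pair : V -> V' -> hom (tunit C) (tunit C))
    n (b : n.-tuple V) (b' : n.-tuple V') :=
  [/\ basis_of fullv b, basis_of fullv b'
    & forall i j : 'I_n, pair (tnth b i) (tnth b' j) = (i == j)%:R *: idm (tunit C)].

Definition hb_pairing W Y Z (i : hom Y (W ⊗ Z)) (j : hom (dual Y ⊗ W) (dual Z)) :
    hom (tunit C) (tunit C) :=
  ev Z ∘ (j ⊗ₘ idm Z) ∘ assoc_inv (dual Y) W Z ∘ (idm (dual Y) ⊗ₘ i)
  ∘ rcoev (sph_piv C) Y.

Definition hb_term W Y Z (i : hom Y (W ⊗ Z)) (i' : hom (dual Y ⊗ W) (dual Z)) :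
    hom ((Y ⊗ dual Y) ⊗ W) (W ⊗ (Z ⊗ dual Z)) :=
  assoc W Z (dual Z) ∘ (i ⊗ₘ i') ∘ assoc Y (dual Y) W.

Definition e_pairing X Y Z (i : hom (Y ⊗ dual X) (dual Z)) (j : hom X (Z ⊗ Y)) :
    hom (tunit C) (tunit C) :=
  rev (sph_piv C) Z ∘ (idm Z ⊗ₘ i) ∘ assoc Z Y (dual X) ∘ (j ⊗ₘ idm (dual X))
  ∘ coev X.

Definition e_term X Y Z (i : hom (Y ⊗ dual X) (dual Z)) (i' : hom X (Z ⊗ Y)) :
    hom (X ⊗ dual X) (Z ⊗ dual Z) :=
  (idm Z ⊗ₘ i) ∘ assoc Z Y (dual X) ∘ (i' ⊗ₘ idm (dual X)).

Variables (Irr : Type) (irr : Irr -> C) (sq : Irr -> K).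

Definition is_hb_component W (Y Z : Irr)
    (f : hom ((irr Y ⊗ dual (irr Y)) ⊗ W) (W ⊗ (irr Z ⊗ dual (irr Z)))) :=
  exists n (b : n.-tuple (hom (irr Y) (W ⊗ irr Z)))
         (b' : n.-tuple (hom (dual (irr Y) ⊗ W) (dual (irr Z)))),
    dual_bases (@hb_pairing W (irr Y) (irr Z)) b b'
    /\ f = (sq Y * sq Z) *: \sum_(k < n) hb_term (tnth b k) (tnth b' k).

Definition is_e_component (Y X Z : Irr)
    (f : hom (irr X ⊗ dual (irr X)) (irr Z ⊗ dual (irr Z))) :=
  exists n (b : n.-tuple (hom (irr Y ⊗ dual (irr X)) (dual (irr Z))))
         (b' : n.-tuple (hom (irr X) (irr Z ⊗ irr Y))),
    dual_bases (@e_pairing (irr X) (irr Y) (irr Z)) b b'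
    /\ f = (sdim (irr Y) * sq X * sq Z) *: \sum_(k < n) e_term (tnth b k) (tnth b' k).

End Elements.

(* Main.v *)
From HB Require Import structures.
From mathcomp Require Import all_boot all_order all_algebra.
From mathcomp Require Import all_classical all_reals.
From mathcomp Require Import ring.
Require Import Defs.

Set Implicit Arguments.
Unset Strict Implicit.
Unset Printing Implicit Defensive.

Import GRing.Theory.
Local Open Scope ring_scope.
Local Open Scope cat_scope.

(** Fix simple objects X and W.  For an object T, a morphism from T ⊗ dual X to
    dual W and a morphism from X to W ⊗ T pair to a scalar, and they also
    compose to the morphism [transfer] from X ⊗ dual X to W ⊗ dual W, in which
    the strand T leaves the first factor and is absorbed by the second.  The
    element e_Y has as its components, up to d_Y and the square roots of
    dimensions, the sum of [transfer] over dual bases for T := Y.  Such a sum is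
    the image of the copairing inverse to the pairing, so any two families
    realising the copairing give the same sum ([copairing_unique]).

    The theorem compares two such families for the one object T := Y ⊗ Z.

    - Decompose Y ⊗ Z into simple objects and collect dual bases for the
      summands.  Since [transfer] lets morphisms of T slide through it
      ([transfer_slide]), the sum is the sum over the summands U of the
      corresponding components of e_U, where U occurs as often as the dimension
      of the space of morphisms from Y ⊗ Z to U ([multiplicity]).

    - Compose dual bases for Z, between X and a simple object V, with dual bases
      for Y, between V and W, for all V.  By the pentagon, composing two
      transfers gives the transfer along Y ⊗ Z of the composites
      ([transfer_comp]), so the sum is a sum over V of products of a component
      of e_Y with a component of e_Z.

    The composites in the second family pair to the product of the two pairings
    divided by d_V, and to zero when two different objects V are involved
    ([e_pairing_fuse], [e_pairing_fuse_same]).  The reason is Schur's lemma: a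
    morphism from the unit to V ⊗ dual U is the bending of a morphism from U to
    V, hence zero or a multiple of the coevaluation ([unit_to_irr_dual]).  The
    factor d_V which corrects this normalisation is the product of the two
    factors sqrt d_V contributed by the middle object in the components of e_Y
    and of e_Z.  Equality of the two sums ([transfer_tensor]) is thus the
    asserted identity, once d_U has been cancelled ([sdim_irr_neq0]). *)

(** * Linear maps *)

Section LinearMaps.
Variable K : fieldType.

Lemma linear_function_sum (U V : lmodType K) (f : U -> V) (flin : linear f)
    (I : Type) (r : seq I) (P : pred I) (F : I -> U) :
  f (\sum_(i <- r | P i) F i) = \sum_(i <- r | P i) f (F i).
Proof.
pose F' := HB.pack_for {linear U -> V} f (GRing.isLinear.Build K U V *:%R f flin).
exact: (raddf_sum F').
Qed.

Lemma linear_function0 (U V : lmodType K) (f : U -> V) : linear f -> f 0 = 0.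
Proof. by move=> flin; have := flin (-1) 0 0; rewrite !scaleN1r !addNr. Qed.

Lemma linear_functionZ (U V : lmodType K) (f : U -> V) :
  linear f -> forall a u, f (a *: u) = a *: f u.
Proof. by move=> flin a u; rewrite -[a *: u]addr0 flin linear_function0 // addr0. Qed.

Lemma linear_functionB (U V : lmodType K) (f : U -> V) :
  linear f -> forall u v, f (u - v) = f u - f v.
Proof. by move=> flin u v; rewrite -scaleN1r addrC flin scaleN1r addrC. Qed.

End LinearMaps.

Section Eigenvectors.
Variables (K : closedFieldType) (V : vectType K).
Import VectorInternalTheory.

(** The characteristic polynomial of f in coordinates is not constant, because V
    is nonzero, so it has a root. *)
Lemma closed_field_eigenvector (f : V -> V) (flin : linear f) (v0 : V) :
  v0 != 0 -> exists a v, v != 0 /\ f v = a *: v.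
Proof.
move=> v0_nz; pose F := HB.pack_for {linear V -> V} f (GRing.isLinear.Build K V V *:%R f flin).
pose A := lin1_mx (v2r \o F \o r2v).
have [|a] := closed_rootP (char_poly A) _.
  rewrite size_char_poly; apply: contraNneq v0_nz => -[V0].
  rewrite -(inj_eq (@v2r_inj _ V)) linear0; apply/eqP/rowP => -[i lti].
  by exfalso; rewrite V0 in lti.
rewrite -eigenvalue_root_char => /eigenvalueP[v /= vA v_nz].
exists a, (r2v v); split.
  by apply: contraNneq v_nz => /(congr1 v2r); rewrite r2vK linear0 => ->.
by apply: v2r_inj; rewrite linearZ /= r2vK -vA mul_rV_lin1.
Qed.

End Eigenvectors.

(** * Schur's lemma *)

Section LinearCategory.
Variables (K : fieldType) (C : lincat K).
Implicit Types X Y Z : C.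

Lemma comp0m X Y Z (f : hom X Y) : (0 : hom Y Z) ∘ f = 0.
Proof. exact: (linear_function0 (comp_linear_l f)). Qed.

Lemma compm0 X Y Z (g : hom Y Z) : g ∘ (0 : hom X Y) = 0.
Proof. exact: (linear_function0 (comp_linear_r g)). Qed.

Lemma compZl X Y Z (g : hom Y Z) (f : hom X Y) a : (a *: g) ∘ f = a *: (g ∘ f).
Proof. exact: (linear_functionZ (comp_linear_l f)). Qed.

Lemma compZr X Y Z (g : hom Y Z) (f : hom X Y) a : g ∘ (a *: f) = a *: (g ∘ f).
Proof. exact: (linear_functionZ (comp_linear_r g)). Qed.

Lemma compBl X Y Z (g g' : hom Y Z) (f : hom X Y) : (g - g') ∘ f = g ∘ f - g' ∘ f.
Proof. exact: (linear_functionB (comp_linear_l f)). Qed.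

Lemma compBr X Y Z (g : hom Y Z) (f f' : hom X Y) : g ∘ (f - f') = g ∘ f - g ∘ f'.
Proof. exact: (linear_functionB (comp_linear_r g)). Qed.

Lemma comp_suml X Y Z (I : Type) (r : seq I) (P : pred I) (g : I -> hom Y Z) (f : hom X Y) :
  (\sum_(i <- r | P i) g i) ∘ f = \sum_(i <- r | P i) g i ∘ f.
Proof. exact: (linear_function_sum (comp_linear_l f)). Qed.

Lemma comp_sumr X Y Z (I : Type) (r : seq I) (P : pred I) (g : hom Y Z) (f : I -> hom X Y) :
  g ∘ (\sum_(i <- r | P i) f i) = \sum_(i <- r | P i) g ∘ f i.
Proof. exact: (linear_function_sum (comp_linear_r g)). Qed.

Lemma simple_id_neq0 X : simple X -> idm X != 0.
Proof.
move=> [nzX _]; apply/eqP => id0; apply: nzX => Y; split=> f.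
  by rewrite -[f]comp1m id0 comp0m.
by rewrite -[f]compm1 id0 compm0.
Qed.

Hypothesis abC : abelian C.

(** The kernel of f is a subobject of X, so it is zero or all of X; the latter
    would make f zero.  Hence f is mono, a nonzero subobject of Y. *)
Lemma simple_hom_iso X Y (f : hom X Y) : simple X -> simple Y -> f != 0 -> iso f.
Proof.
move=> simX [_ simY] f_nz.
have [N [k [fk0 kP]]] := has_kernels abC f.
case: (simX) => _ /(_ N k); case.
- move=> T u v kuv.
  have [|w [_ wU]] := kP T (k ∘ u); first by rewrite compA fk0 comp0m.
  by rewrite -(wU u) // -(wU v).
- move=> N0; case: (simY X f) => // [T u v fuv | X0]; last by case: simX => /(_ X0).
  have [|w [kw _]] := kP T (u - v); first by rewrite compBr fuv subrr.
  by move/eqP: kw; rewrite ((N0 T).1 w) compm0 eq_sym subr_eq0 => /eqP.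
- case=> g [_ kg]; case/eqP: f_nz.
  by rewrite -[f]compm1 -kg compA fk0 comp0m.
Qed.

End LinearCategory.

Section Schur.
Variables (K : closedFieldType) (C : lincat K).
Hypothesis abC : abelian C.

(** Composition with f is an endomorphism of a nonzero space, so it has an
    eigenvector v, of eigenvalue a say; f - a would cancel v if it were
    invertible, so it is zero. *)
Lemma simple_end_scalar (X : C) (f : hom X X) : simple X -> exists a, f = a *: idm X.
Proof.
move=> simX.
have [a [v [v_nz fv]]] := closed_field_eigenvector (comp_linear_r f) (simple_id_neq0 simX).
exists a; apply/eqP; rewrite -subr_eq0; apply: contraNT v_nz.
move=> /(simple_hom_iso abC simX simX)[g [gf _]].
by rewrite -[v]comp1m -gf -compA compBl compZl comp1m fv subrr compm0.
Qed.
End Schur.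

(** * Decompositions into simple objects *)

Section Biproducts.
Variables (K : fieldType) (C : lincat K) (I : finType).
Implicit Types X Y : C.

Lemma biproduct_ext (F G : I -> C) A B (a : biproduct F A) (b : biproduct G B) (f g : hom A B) :
  (forall i j, bp_proj b j ∘ f ∘ bp_inj a i = bp_proj b j ∘ g ∘ bp_inj a i) -> f = g.
Proof.
move=> fg.
have expand h : h = \sum_j \sum_i
    bp_inj b j ∘ (bp_proj b j ∘ h ∘ bp_inj a i) ∘ bp_proj a i.
  rewrite -[LHS]comp1m -[LHS]compm1 -(bp_sum a) -(bp_sum b) comp_suml comp_suml.
  by apply: eq_bigr => j _; rewrite comp_sumr; apply: eq_bigr => i _; rewrite !compA.
rewrite (expand f) (expand g); apply: eq_bigr => j _; apply: eq_bigr => i _.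
by rewrite fg.
Qed.

Definition biproduct_iso (F G : I -> C) B (bp : biproduct F B)
    (f : forall i, hom (F i) (G i)) (g : forall i, hom (G i) (F i))
    (gf : forall i, g i ∘ f i = idm (F i)) (fg : forall i, f i ∘ g i = idm (G i)) :
  biproduct G B.
Proof.
exists (fun i => bp_inj bp i ∘ g i) (fun i => f i ∘ bp_proj bp i) => [i | i j ij |].
- by rewrite compA -(compA (f i)) bp_projK compm1 fg.
- by rewrite compA -(compA (f j)) bp_proj_inj0 // compm0 comp0m.
- rewrite -(bp_sum bp); apply: eq_bigr => i _.
  by rewrite compA -(compA _ (g i)) gf compm1.
Defined.

(** Composition with the projections embeds the spaces hom (F i) X, and hom B X
    is the direct sum of their images. *)
Lemma dim_hom_biproduct (F : I -> C) B (bp : biproduct F B) X :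
  \dim {: hom B X} = (\sum_i \dim {: hom (F i) X})%N.
Proof.
pose P i := HB.pack_for {linear hom (F i) X -> hom B X} (fun f => f ∘ bp_proj bp i)
  (GRing.isLinear.Build K (hom (F i) X) (hom B X) *:%R _ (comp_linear_l (bp_proj bp i))).
have PE i f : linfun (P i) f = f ∘ bp_proj bp i by rewrite lfunE.
have dimP i : \dim (limg (linfun (P i))) = \dim {: hom (F i) X}.
  apply: limg_dim_eq; apply/eqP; rewrite -subv0; apply/subvP => f.
  rewrite memv_cap => /andP[_]; rewrite memv_ker PE memv0 => /eqP fp0.
  by rewrite -[f]compm1 -(bp_projK bp i) compA fp0 comp0m.
have dirP : directv (\sum_i limg (linfun (P i)))%VS.
  apply/directv_sum_independent => us usP us0 i _.
  have /all_sig[v vE] j : {v | us j = v ∘ bp_proj bp j}.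
    by have /memv_imgP/cid2[v _ ->] := usP j isT; exists v; rewrite PE.
  have: (\sum_j us j) ∘ bp_inj bp i = v i.
    rewrite comp_suml (bigD1 i) //= big1 ?addr0 => [|j ji].
      by rewrite vE -compA bp_projK compm1.
    by rewrite vE -compA bp_proj_inj0 ?compm0 // eq_sym.
  by rewrite us0 comp0m vE => <-; rewrite comp0m.
rewrite -(eq_bigr _ (fun i _ => dimP i)) -(directvP dirP) /=.
congr (\dim _); apply/eqP; rewrite eq_sym eqEsubv subvf /=; apply/subvP => f _.
rewrite -[f]compm1 -(bp_sum bp) comp_sumr; apply: rpred_sum => i _.
rewrite compA -PE; apply: subv_trans (sumv_sup i _ (subvv _)) => //.
exact: (memv_img _ (memvf _)).
Qed.

End Biproducts.

Section Irreducibles.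
Variables (K : closedFieldType) (C : lincat K) (Irr : finType) (irr : Irr -> C).
Hypotheses (abC : abelian C) (ssC : semisimple C) (irrP : simple_representatives irr).

Lemma irr_hom0 i j (f : hom (irr i) (irr j)) : i != j -> f = 0.
Proof.
move=> /eqP ij; apply: contra_notP ij => /eqP f_nz; apply: (repr_inj irrP).
by exists f; apply: simple_hom_iso => //; apply: (repr_simple irrP).
Qed.

Lemma dim_hom_irr i j : \dim {: hom (irr i) (irr j)} = (i == j).
Proof.
have [->|ij] := eqVneq i j; last first.
  by apply/eqP; rewrite dimv_eq0 -subv0; apply/subvP => f _; rewrite (irr_hom0 f) ?mem0v.
have simj := repr_simple irrP j.
have -> : fullv = <[idm (irr j)]>%VS.
  apply/eqP; rewrite eq_sym eqEsubv subvf; apply/subvP => f _.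
  by have [a ->] := simple_end_scalar abC f simj; rewrite memvZ ?memv_line.
by rewrite dim_vline simple_id_neq0.
Qed.

Lemma irr_decomposition X :
  exists n (c : 'I_n -> Irr), inhabited (biproduct (irr \o c) X).
Proof.
have [n [F [simF [bp]]]] := ssC X.
have /all_sig[c cP] m : {j | isomorphic (F m) (irr j)}.
  by have /cid := repr_surj irrP (simF m).
have /all_sig[f fP] m : {f : hom (F m) (irr (c m)) | iso f} by exact/cid/cP.
have /all_sig[g gP] m : {g | g ∘ f m = idm _ /\ f m ∘ g = idm _} by exact/cid/fP.
exists n, c; constructor.
exact: (biproduct_iso bp (fun m => (gP m).1) (fun m => (gP m).2)).
Qed.

Lemma multiplicity X n (c : 'I_n -> Irr) (bp : biproduct (irr \o c) X) i :
  \dim {: hom X (irr i)} = #|[pred m | c m == i]|.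
Proof.
rewrite (dim_hom_biproduct bp) (eq_bigr _ (fun m _ => dim_hom_irr (c m) i)).
by rewrite -big_mkcond sum1_card.
Qed.

End Irreducibles.

(** * Coherence in monoidal categories *)

Section Coherence.
Variables (K : fieldType) (C : moncat K).
Implicit Types X Y Z W T : C.

Lemma tens_compl X X' X'' Y (f' : hom X' X'') (f : hom X X') :
  (f' ∘ f) ⊗ₘ idm Y = (f' ⊗ₘ idm Y) ∘ (f ⊗ₘ idm Y).
Proof. by rewrite -tensm_comp comp1m. Qed.

Lemma tens_compr X Y Y' Y'' (g' : hom Y' Y'') (g : hom Y Y') :
  idm X ⊗ₘ (g' ∘ g) = (idm X ⊗ₘ g') ∘ (idm X ⊗ₘ g).
Proof. by rewrite -tensm_comp comp1m. Qed.

Lemma tens_exchange X X' Y Y' (f : hom X X') (g : hom Y Y') :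
  (f ⊗ₘ idm Y') ∘ (idm X ⊗ₘ g) = (idm X' ⊗ₘ g) ∘ (f ⊗ₘ idm Y).
Proof. by rewrite -!tensm_comp !comp1m !compm1. Qed.

Lemma comp_split_epi X Y Z (f g : hom Y Z) (h : hom X Y) (h' : hom Y X) :
  h ∘ h' = idm Y -> f ∘ h = g ∘ h -> f = g.
Proof. by move=> hh' fg; rewrite -[f]compm1 -hh' compA fg -compA hh' compm1. Qed.

Lemma comp_split_mono X Y Z (f g : hom X Y) (h : hom Y Z) (h' : hom Z Y) :
  h' ∘ h = idm Y -> h ∘ f = h ∘ g -> f = g.
Proof. by move=> hh' fg; rewrite -[f]comp1m -hh' -compA fg compA hh' comp1m. Qed.

Lemma tens_unitl_inj X Y (f g : hom X Y) : idm (tunit C) ⊗ₘ f = idm (tunit C) ⊗ₘ g -> f = g.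
Proof. by move=> fg; apply: (comp_split_epi (lunitVK X)); rewrite -!lunit_nat fg. Qed.

Lemma tens_unitr_inj X Y (f g : hom X Y) : f ⊗ₘ idm (tunit C) = g ⊗ₘ idm (tunit C) -> f = g.
Proof. by move=> fg; apply: (comp_split_epi (runitVK X)); rewrite -!runit_nat fg. Qed.

Lemma assoc_inv_nat X X' Y Y' Z Z' (f : hom X X') (g : hom Y Y') (h : hom Z Z') :
  assoc_inv X' Y' Z' ∘ (f ⊗ₘ (g ⊗ₘ h)) = ((f ⊗ₘ g) ⊗ₘ h) ∘ assoc_inv X Y Z.
Proof.
apply: (comp_split_mono (assocK _ _ _)); rewrite !compA assocVK comp1m assoc_nat.
by rewrite -compA assocVK compm1.
Qed.

Lemma lunit_inv_nat X Y (f : hom X Y) : lunit_inv Y ∘ f = (idm _ ⊗ₘ f) ∘ lunit_inv X.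
Proof.
apply: (comp_split_mono (lunitK _)); rewrite !compA lunitVK comp1m lunit_nat.
by rewrite -compA lunitVK compm1.
Qed.

Lemma runit_inv_nat X Y (f : hom X Y) : runit_inv Y ∘ f = (f ⊗ₘ idm _) ∘ runit_inv X.
Proof.
apply: (comp_split_mono (runitK _)); rewrite !compA runitVK comp1m runit_nat.
by rewrite -compA runitVK compm1.
Qed.

Lemma assoc_inv_split X Y Z T :
  (assoc X Y Z ⊗ₘ idm T) ∘ (assoc_inv X Y Z ⊗ₘ idm T) = idm _.
Proof. by rewrite -tens_compl assocVK tensm_id. Qed.

(** Kelly's argument, here and in the next lemma: tensoring with the unit is
    faithful, and after tensoring the claim is what remains of a pentagon with
    two unit entries once the triangle and naturality are applied. *)
Lemma lunit_tens X Y : lunit (X ⊗ Y) ∘ assoc (tunit C) X Y = lunit X ⊗ₘ idm Y.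
Proof.
apply: tens_unitl_inj.
apply: (comp_split_epi (h := assoc _ (tunit C ⊗ X) Y ∘ (assoc _ _ X ⊗ₘ idm Y))
          (h' := (assoc_inv _ _ X ⊗ₘ idm Y) ∘ assoc_inv _ (tunit C ⊗ X) Y)).
  by rewrite -compA (compA (_ ⊗ₘ _)) assoc_inv_split comp1m assocVK.
rewrite tens_compr -compA (compA (idm _ ⊗ₘ assoc _ _ _)) -pentagon compA triangle.
rewrite -(tensm_id X Y) -assoc_nat -triangle tens_compl compA assoc_nat.
by rewrite compA.
Qed.

Lemma runit_tens X Y : (idm X ⊗ₘ runit Y) ∘ assoc X Y (tunit C) = runit (X ⊗ Y).
Proof.
apply: tens_unitr_inj; apply: (comp_split_mono (assocK X Y (tunit C))).
rewrite -triangle compA -(tensm_id X Y) assoc_nat -compA pentagon !compA.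
by rewrite -tens_compr triangle -assoc_nat -compA -tens_compl.
Qed.

Lemma lunit_unit : lunit (tunit C) = runit (tunit C).
Proof.
apply: tens_unitr_inj; rewrite -lunit_tens -triangle; congr (_ ∘ _).
by apply: (comp_split_mono (lunitK _)); rewrite lunit_nat.
Qed.

Lemma lunit_inv_unit : lunit_inv (tunit C) = runit_inv (tunit C).
Proof.
apply: (comp_split_mono (lunitK _)); rewrite lunitVK lunit_unit.
by rewrite runitVK.
Qed.

Lemma lunit_inv_tens X Y :
  lunit_inv X ⊗ₘ idm Y = assoc_inv (tunit C) X Y ∘ lunit_inv (X ⊗ Y).
Proof.
apply: (comp_split_mono (h := lunit X ⊗ₘ idm Y) (h' := lunit_inv X ⊗ₘ idm Y)).
  by rewrite -tens_compl lunitK tensm_id.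
rewrite -tens_compl lunitVK tensm_id -lunit_tens -compA (compA (assoc _ _ _)).
by rewrite assocVK comp1m lunitVK.
Qed.

Lemma runit_inv_tens X Y :
  assoc X Y (tunit C) ∘ runit_inv (X ⊗ Y) = idm X ⊗ₘ runit_inv Y.
Proof.
apply: (comp_split_mono (h := idm X ⊗ₘ runit Y) (h' := idm X ⊗ₘ runit_inv Y)).
  by rewrite -tens_compr runitK tensm_id.
by rewrite compA runit_tens runitVK -tens_compr runitVK tensm_id.
Qed.

Lemma tensmZl X X' Y Y' (f : hom X X') (g : hom Y Y') a : (a *: f) ⊗ₘ g = a *: (f ⊗ₘ g).
Proof. exact: (linear_functionZ (tensm_linear_l g)). Qed.

Lemma tens0m X X' Y Y' (g : hom Y Y') : (0 : hom X X') ⊗ₘ g = 0.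
Proof. exact: (linear_function0 (tensm_linear_l g)). Qed.

Lemma tens_suml X X' Y Y' (I : Type) (r : seq I) (P : pred I) (f : I -> hom X X')
    (g : hom Y Y') :
  (\sum_(i <- r | P i) f i) ⊗ₘ g = \sum_(i <- r | P i) f i ⊗ₘ g.
Proof. exact: (linear_function_sum (tensm_linear_l g)). Qed.


Section Name.
Variables (X D : C) (evX : hom (D ⊗ X) (tunit C)) (coevX : hom (tunit C) (X ⊗ D)).

(** Bends the strand D of g back with the evaluation. *)
Definition unname V (g : hom (tunit C) (V ⊗ D)) : hom X V :=
  runit V ∘ (idm V ⊗ₘ evX) ∘ assoc V D X ∘ (g ⊗ₘ idm X) ∘ lunit_inv X.

Hypothesis dualX : is_dual evX coevX.

(** Pulling g past the coevaluation leaves V tensored with the second zigzag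
    identity.  It follows that g is determined by [unname g]. *)
Lemma name_unname V (g : hom (tunit C) (V ⊗ D)) : (unname g ⊗ₘ idm D) ∘ coevX = g.
Proof.
have right_half : ((g ⊗ₘ idm X) ⊗ₘ idm D) ∘ (lunit_inv X ⊗ₘ idm D) ∘ coevX
    = assoc_inv (V ⊗ D) X D ∘ (idm (V ⊗ D) ⊗ₘ coevX) ∘ runit_inv (V ⊗ D) ∘ g.
  rewrite lunit_inv_tens -!compA lunit_inv_nat !compA -assoc_inv_nat tensm_id.
  rewrite -!compA (compA (g ⊗ₘ idm _)) tens_exchange -compA.
  by rewrite lunit_inv_unit -runit_inv_nat.
have left_half : (runit V ⊗ₘ idm D) ∘ ((idm V ⊗ₘ evX) ⊗ₘ idm D) ∘ (assoc V D X ⊗ₘ idm D)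
      ∘ (assoc_inv (V ⊗ D) X D ∘ (idm (V ⊗ D) ⊗ₘ coevX) ∘ runit_inv (V ⊗ D))
    = idm (V ⊗ D).
  (* the pentagon for V, D, X, D, solved for the inner associator *)
  have pent : assoc V (D ⊗ X) D ∘ (assoc V D X ⊗ₘ idm D) ∘ assoc_inv (V ⊗ D) X D
      = (idm V ⊗ₘ assoc_inv D X D) ∘ assoc V D (X ⊗ D).
    apply: (comp_split_mono (h := idm V ⊗ₘ assoc D X D) (h' := idm V ⊗ₘ assoc_inv D X D)).
      by rewrite -tens_compr assocK tensm_id.
    rewrite !compA -pentagon -compA assocVK compm1 -tens_compr assocVK tensm_id.
    by rewrite comp1m.
  rewrite -triangle -(compA (idm V ⊗ₘ _)) assoc_nat !compA -tens_compr.
  rewrite -(compA _ (assoc V _ _)) -(compA _ (_ ∘ _) (assoc_inv _ _ _)) pent.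
  rewrite !compA -tens_compr -(compA _ (assoc V _ _)) -(tensm_id V D) assoc_nat.
  rewrite compA -(compA _ (assoc V _ _)) runit_inv_tens -!tens_compr.
  by rewrite dualX.2 !tensm_id.
rewrite /unname !tens_compl -!compA (compA ((g ⊗ₘ _) ⊗ₘ _)) right_half.
by rewrite !compA in left_half *; rewrite left_half comp1m.
Qed.

End Name.

End Coherence.

(** * Moving a tensor factor across a product *)

Section Transfer.
Variables (K : fieldType) (C : moncat K).
Implicit Types X Y Z D : C.

Definition transfer X Y Z D D' (i : hom (Y ⊗ D) D') (j : hom X (Z ⊗ Y)) :
    hom (X ⊗ D) (Z ⊗ D') :=
  (idm Z ⊗ₘ i) ∘ assoc Z Y D ∘ (j ⊗ₘ idm D).

Lemma transfer_linear_l X Y Z D D' (j : hom X (Z ⊗ Y)) :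
  linear (fun i : hom (Y ⊗ D) D' => transfer i j).
Proof. by move=> a u v; rewrite /transfer tensm_linear_r !comp_linear_l. Qed.

Lemma transfer_linear_r X Y Z D D' (i : hom (Y ⊗ D) D') :
  linear (fun j : hom X (Z ⊗ Y) => transfer i j).
Proof. by move=> a u v; rewrite /transfer tensm_linear_l comp_linear_r. Qed.

Lemma transfer_slide X Y Y' Z D D' (i : hom (Y' ⊗ D) D') (f : hom Y Y') (j : hom X (Z ⊗ Y)) :
  transfer (i ∘ (f ⊗ₘ idm D)) j = transfer i ((idm Z ⊗ₘ f) ∘ j).
Proof.
rewrite /transfer tens_compr tens_compl !compA; congr (_ ∘ _).
by rewrite -!compA; congr (_ ∘ _); rewrite assoc_nat.
Qed.

(** [fuse_first g h] and [fuse_second i j] are what becomes of the two ends of the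
    strands Y and Z, seen as a single strand Y ⊗ Z, in the composite of
    [transfer j h] and [transfer i g]. *)
Definition fuse_first W V X Y Z (g : hom V (W ⊗ Y)) (h : hom X (V ⊗ Z)) : hom X (W ⊗ (Y ⊗ Z)) :=
  assoc W Y Z ∘ (g ⊗ₘ idm Z) ∘ h.

Definition fuse_second Y Z D D' D'' (i : hom (Y ⊗ D') D'') (j : hom (Z ⊗ D) D') :
    hom ((Y ⊗ Z) ⊗ D) D'' :=
  i ∘ (idm Y ⊗ₘ j) ∘ assoc Y Z D.

(** g and j act on different factors, so they can be exchanged; the associators
    that remain on the two sides are those of the pentagon for W, Y, Z, D. *)
Lemma transfer_comp W V X Y Z D D' D'' (i : hom (Y ⊗ D') D'') (g : hom V (W ⊗ Y))
    (j : hom (Z ⊗ D) D') (h : hom X (V ⊗ Z)) :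
  transfer i g ∘ transfer j h = transfer (fuse_second i j) (fuse_first g h).
Proof.
rewrite /transfer /fuse_first /fuse_second !tens_compr !tens_compl !compA.
congr (_ ∘ _).
rewrite -!compA; congr (_ ∘ _); rewrite !compA.
rewrite -(compA (assoc _ _ _)) tens_exchange -(tensm_id W Y) !compA assoc_nat.
rewrite -!compA; congr (_ ∘ _); rewrite -(tensm_id Z D) -assoc_nat !compA.
by rewrite pentagon.
Qed.

Lemma fuse_first_linear_l W V X Y Z (h : hom X (V ⊗ Z)) :
  linear (fun g : hom V (W ⊗ Y) => fuse_first g h).
Proof. by move=> a u v; rewrite /fuse_first tensm_linear_l comp_linear_r comp_linear_l. Qed.

Lemma fuse_first_linear_r W V X Y Z (g : hom V (W ⊗ Y)) :
  linear (fun h : hom X (V ⊗ Z) => fuse_first g h).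
Proof. by move=> a u v; rewrite /fuse_first comp_linear_r. Qed.

End Transfer.

(** * Copairings *)

Section Copairings.
Variables (K : fieldType).

Lemma sum_tagged (M : nmodType) (I : finType) (J : I -> finType) (F : forall i, J i -> M) :
  \sum_(a : {i : I & J i}) F (tag a) (tagged a) = \sum_i \sum_(j : J i) F i j.
Proof. by rewrite sig_big_dep. Qed.

(** The hypotheses are the two halves of the zigzag identity for a copairing, each
    asked of one family.  Expanding every u j by the first and then collecting
    every b' i by the second turns one sum into the other, just as a two-sided
    inverse is unique. *)
Lemma copairing_unique (V V' W : lmodType K) (p : V -> V' -> K) (B : V -> V' -> W)
    (Bl : forall y, linear (B^~ y)) (Br : forall x, linear (B x))
    (I J : finType) (b : I -> V) (b' : I -> V') (u : J -> V) (u' : J -> V') :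
    (forall x, x = \sum_i p x (b' i) *: b i) ->
    (forall y, y = \sum_j p (u j) y *: u' j) ->
  \sum_j B (u j) (u' j) = \sum_i B (b i) (b' i).
Proof.
move=> bE u'E.
transitivity (\sum_j \sum_i p (u j) (b' i) *: B (b i) (u' j)).
  apply: eq_bigr => j _; rewrite [in LHS](bE (u j)) (linear_function_sum (Bl _)).
  by apply: eq_bigr => i _; rewrite (linear_functionZ (Bl _)).
rewrite exchange_big; apply: eq_bigr => i _; rewrite [in RHS](u'E (b' i)).
rewrite (linear_function_sum (Br _)); apply: eq_bigr => j _.
by rewrite (linear_functionZ (Br _)).
Qed.

End Copairings.

Section UnitScalars.
Variables (K : fieldType) (C : sphericalFusionCat K).

Let simple_unit : simple (tunit C) := fusion_unit (sph_fusion C).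

Lemma unit_coef1 : unit_coef (idm (tunit C)) = 1.
Proof.
rewrite /unit_coef; have := @coord_free _ _ _ [tuple idm (tunit C)] ord0 ord0.
by rewrite /= => -> //; rewrite seq1_free simple_id_neq0.
Qed.

Lemma unit_coefZ a (f : hom (tunit C) (tunit C)) : unit_coef (a *: f) = a * unit_coef f.
Proof. by rewrite /unit_coef linearZ. Qed.

Lemma unit_coef0 : unit_coef (0 : hom (tunit C) (tunit C)) = 0.
Proof. by rewrite /unit_coef linear0. Qed.

Lemma unit_coefD (f g : hom (tunit C) (tunit C)) :
  unit_coef (f + g) = unit_coef f + unit_coef g.
Proof. by rewrite /unit_coef linearD. Qed.

Lemma unit_coef_sum (I : Type) (r : seq I) (P : pred I) (F : I -> hom (tunit C) (tunit C)) :
  unit_coef (\sum_(i <- r | P i) F i) = \sum_(i <- r | P i) unit_coef (F i).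
Proof. by rewrite /unit_coef linear_sum. Qed.

(** The coordinates in a basis are the pairings with the dual basis. *)
Lemma dual_bases_copairing (V V' : vectType K) (q : V -> V' -> hom (tunit C) (tunit C))
    (ql : forall y, linear (q^~ y)) (qr : forall x, linear (q x))
    n (b : n.-tuple V) (b' : n.-tuple V') :
    dual_bases q b b' ->
  (forall x, x = \sum_k unit_coef (q x (tnth b' k)) *: tnth b k) /\
  (forall y, y = \sum_k unit_coef (q (tnth b k) y) *: tnth b' k).
Proof.
case=> bV b'V bb'; split=> x.
- rewrite [LHS](coord_basis bV (memvf x)); apply: eq_bigr => k _.
  rewrite -tnth_nth; congr (_ *: _).
  rewrite [in RHS](coord_basis bV (memvf x)) (linear_function_sum (ql _)) unit_coef_sum.
  rewrite (bigD1 k) //= big1 ?addr0 => [|l lk];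
    rewrite (linear_functionZ (ql _)) unit_coefZ -tnth_nth bb' unit_coefZ unit_coef1.
    by rewrite eqxx !mulr1.
  by rewrite (negPf lk) mul0r mulr0.
- rewrite [LHS](coord_basis b'V (memvf x)); apply: eq_bigr => k _.
  rewrite -tnth_nth; congr (_ *: _).
  rewrite [in RHS](coord_basis b'V (memvf x)) (linear_function_sum (qr _)) unit_coef_sum.
  rewrite (bigD1 k) //= big1 ?addr0 => [|l lk];
    rewrite (linear_functionZ (qr _)) unit_coefZ -tnth_nth bb' unit_coefZ unit_coef1.
    by rewrite eqxx !mulr1.
  by rewrite eq_sym (negPf lk) mul0r mulr0.
Qed.

Lemma e_pairingE (X Y Z : C) (i : hom (Y ⊗ dual X) (dual Z)) (j : hom X (Z ⊗ Y)) :
  e_pairing i j = rev (sph_piv C) Z ∘ transfer i j ∘ coev X.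
Proof. by rewrite /e_pairing /transfer !compA. Qed.

Lemma e_pairing_linear_l (X Y Z : C) (j : hom X (Z ⊗ Y)) :
  linear (fun i : hom (Y ⊗ dual X) (dual Z) => e_pairing i j).
Proof.
move=> a u v; rewrite !e_pairingE transfer_linear_l comp_linear_r.
by rewrite comp_linear_l.
Qed.

Lemma e_pairing_linear_r (X Y Z : C) (i : hom (Y ⊗ dual X) (dual Z)) :
  linear (fun j : hom X (Z ⊗ Y) => e_pairing i j).
Proof.
move=> a u v; rewrite !e_pairingE transfer_linear_r comp_linear_r.
by rewrite comp_linear_l.
Qed.

Lemma sdimE (X : C) : sdim X = unit_coef (rev (sph_piv C) X ∘ coev X).
Proof. by rewrite /sdim /trace_r tensm_id compm1. Qed.

End UnitScalars.

(** * The fusion rule *)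

Section FusionRule.
Variables (K : closedFieldType) (C : sphericalFusionCat K).
Variables (Irr : finType) (irr : Irr -> C).
Hypothesis irrP : simple_representatives irr.

Let abC : abelian C := fusion_abelian (sph_fusion C).
Let ssC : semisimple C := fusion_semisimple (sph_fusion C).

(** Dual bases of the pairings [e_pairing], known through the expansions they give. *)
Variable rank : Irr -> Irr -> Irr -> nat.
Variable b : forall X Y Z, 'I_(rank X Y Z) -> hom (irr Y ⊗ dual (irr X)) (dual (irr Z)).
Variable b' : forall X Y Z, 'I_(rank X Y Z) -> hom (irr X) (irr Z ⊗ irr Y).
Arguments b : clear implicits.
Arguments b' : clear implicits.

Hypothesis bE : forall X Y Z i,
  i = \sum_k unit_coef (e_pairing i (b' X Y Z k)) *: b X Y Z k.
Hypothesis b'E : forall X Y Z j,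
  j = \sum_k unit_coef (e_pairing (b X Y Z k) j) *: b' X Y Z k.

Let component Y X Z := \sum_k transfer (b X Y Z k) (b' X Y Z k).

(** A morphism from the unit to V ⊗ dual U comes from a morphism from U to V, to
    which Schur's lemma applies; likewise in the next lemma. *)
Lemma unit_to_irr_dual0 U V (g : hom (tunit C) (irr V ⊗ dual (irr U))) : U != V -> g = 0.
Proof.
move=> UV; rewrite -(name_unname (dualP (irr U)) g).
by rewrite (irr_hom0 abC irrP (unname _ _) UV) tens0m comp0m.
Qed.

Lemma unit_to_irr_dual V (g : hom (tunit C) (irr V ⊗ dual (irr V))) :
  exists a, g = a *: coev (irr V).
Proof.
have [a aE] := simple_end_scalar abC (unname (ev (irr V)) g) (repr_simple irrP V).
exists a; rewrite -[LHS](name_unname (dualP (irr V))) aE tensmZl compZl.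
by rewrite tensm_id comp1m.
Qed.

(** Closing the strand Z with an evaluation turns the scalar a into the pairing of
    i and j, and the coevaluation of Z into its dimension. *)
Lemma transfer_coev X Y Z (i : hom (Y ⊗ dual (irr X)) (dual (irr Z)))
    (j : hom (irr X) (irr Z ⊗ Y)) :
  exists a, transfer i j ∘ coev (irr X) = a *: coev (irr Z)
    /\ unit_coef (e_pairing i j) = a * sdim (irr Z).
Proof.
have [a aE] := unit_to_irr_dual (transfer i j ∘ coev (irr X)).
exists a; split=> //.
by rewrite e_pairingE -compA aE compZr unit_coefZ sdimE.
Qed.

(** If the dimension of U were zero, then by [transfer_coev] every pairing into U
    would vanish.  The inverse of the right unit constraint would then pair to zero with
    a basis, although it is not zero. *)
Lemma sdim_irr_neq0 U : sdim (irr U) != 0.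
Proof.
apply/eqP => dU0.
have [U1 [f [g [gf fg]]]] := repr_surj irrP (fusion_unit (sph_fusion C)).
(* the pairing is only known to be perfect on irr U1, so the unit is replaced by it *)
pose h := (idm (irr U) ⊗ₘ f) ∘ runit_inv (irr U).
have h0 : h = 0.
  rewrite (b'E h) big1 // => k _.
  by have [a [_ ->]] := transfer_coev (b U U1 U k) h; rewrite dU0 mulr0 scale0r.
have /eqP[] := simple_id_neq0 (repr_simple irrP U).
rewrite -(runitVK (irr U)) -[runit_inv _]comp1m -tensm_id -gf tens_compr.
by rewrite -compA -/h h0 !compm0.
Qed.

(** The inner transfer, closed at X, is a morphism from the unit to V ⊗ dual V'. *)
Lemma e_pairing_fuse X Y Z V V' W (i : hom (irr Y ⊗ dual (irr V')) (dual (irr W)))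
    (j : hom (irr Z ⊗ dual (irr X)) (dual (irr V')))
    (g : hom (irr V) (irr W ⊗ irr Y)) (h : hom (irr X) (irr V ⊗ irr Z)) :
  V' != V -> e_pairing (fuse_second i j) (fuse_first g h) = 0.
Proof.
move=> VV'; rewrite e_pairingE -transfer_comp -compA -(compA (transfer i g)).
by rewrite (unit_to_irr_dual0 (transfer j h ∘ coev (irr X)) VV') !compm0.
Qed.

(** The inner transfer, closed at X, is a multiple of the coevaluation of V, and
    closing that with the outer transfer gives the pairing of i and g. *)
Lemma e_pairing_fuse_same X Y Z V W (i : hom (irr Y ⊗ dual (irr V)) (dual (irr W)))
    (j : hom (irr Z ⊗ dual (irr X)) (dual (irr V)))
    (g : hom (irr V) (irr W ⊗ irr Y)) (h : hom (irr X) (irr V ⊗ irr Z)) :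
  sdim (irr V) * unit_coef (e_pairing (fuse_second i j) (fuse_first g h))
  = unit_coef (e_pairing i g) * unit_coef (e_pairing j h).
Proof.
rewrite e_pairingE -transfer_comp -compA -(compA (transfer i g)).
have [a [-> ->]] := transfer_coev j h.
by rewrite !compZr unit_coefZ compA -e_pairingE mulrA mulrC [_ * a]mulrC.
Qed.

(** Both sides are sums of [transfer] over a copairing for Y ⊗ Z: v, v' comes from
    the decomposition of Y ⊗ Z, and u, u' from factoring through the objects V,
    the weight in u being the one that [e_pairing_fuse_same] asks for. *)
Lemma transfer_tensor X Y Z W n (c : 'I_n -> Irr) (bp : biproduct (irr \o c) (irr Y ⊗ irr Z)) :
  \sum_V sdim (irr V) *: (component Y V W ∘ component Z X V) = \sum_m component (c m) X W.
Proof.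
pose p (i : hom ((irr Y ⊗ irr Z) ⊗ dual (irr X)) (dual (irr W))) j := unit_coef (e_pairing i j).
pose J V := ('I_(rank V Y W) * 'I_(rank X Z V))%type : finType.
pose u V (a : J V) := sdim (irr V) *: fuse_second (b V Y W a.1) (b X Z V a.2).
pose u' V (a : J V) := fuse_first (b' V Y W a.1) (b' X Z V a.2).
pose v m (k : 'I_(rank X (c m) W)) := b X (c m) W k ∘ (bp_proj bp m ⊗ₘ idm _).
pose v' m (k : 'I_(rank X (c m) W)) := (idm _ ⊗ₘ bp_inj bp m) ∘ b' X (c m) W k.
transitivity (\sum_(a : {V & J V}) transfer (u _ (tagged a)) (u' _ (tagged a))).
  rewrite (sum_tagged (fun V a => transfer (u V a) (u' V a))); apply: eq_bigr => V _.
  rewrite comp_suml scaler_sumr -(pair_bigA _ (fun i j => transfer (u V (i, j)) (u' V (i, j)))).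
  apply: eq_bigr => i _; rewrite comp_sumr scaler_sumr; apply: eq_bigr => j _.
  by rewrite (linear_functionZ (transfer_linear_l _)) transfer_comp.
transitivity (\sum_(a : {m & 'I_(rank X (c m) W)}) transfer (v _ (tagged a)) (v' _ (tagged a))).
  apply: (copairing_unique (p := p)) => [y | x | x | y].
  - exact: transfer_linear_l.
  - exact: transfer_linear_r.
  - rewrite (sum_tagged (fun m k => p x (v' m k) *: v m k)).
    rewrite -[LHS]compm1 -tensm_id -(bp_sum bp) tens_suml comp_sumr.
    apply: eq_bigr => m _; rewrite tens_compl compA.
    rewrite [x ∘ _ in LHS](bE (_ : hom (irr (c m) ⊗ _) _)) comp_suml.
    apply: eq_bigr => k _; rewrite compZl; congr (unit_coef _ *: _).
    by rewrite !e_pairingE transfer_slide.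
  - rewrite (sum_tagged (fun V a => p (u V a) y *: u' V a)).
    (* Q is linear, so it is enough that it fixes the morphisms fuse_first g h: these
       span, as the decomposition of W ⊗ Y into simple objects shows. *)
    pose Q y := \sum_V \sum_(a : J V) p (u V a) y *: u' V a.
    have Qlin : linear Q.
      move=> a y1 y2; rewrite /Q scaler_sumr -big_split; apply: eq_bigr => V _.
      rewrite scaler_sumr -big_split; apply: eq_bigr => l _.
      by rewrite /p e_pairing_linear_r unit_coefD unit_coefZ scalerDl scalerA.
    rewrite -[RHS]/(Q y).
    have Qfuse V (g : hom (irr V) (irr W ⊗ irr Y)) (h : hom (irr X) (irr V ⊗ irr Z)) :
        Q (fuse_first g h) = fuse_first g h.
      rewrite /Q (bigD1 V) //= [X in _ + X]big1 ?addr0 => [|V' VV']; last first.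
        rewrite big1 // => a _.
        rewrite /p (linear_functionZ (e_pairing_linear_l _)) e_pairing_fuse //.
        by rewrite unit_coefZ unit_coef0 mulr0 scale0r.
      rewrite [in RHS](b'E g) (linear_function_sum (fuse_first_linear_l h)).
      rewrite -(pair_bigA _ (fun i j => p (u V (i, j)) (fuse_first g h) *: u' V (i, j))).
      apply: eq_bigr => i _; rewrite (linear_functionZ (fuse_first_linear_l h)).
      rewrite [in RHS](b'E h) (linear_function_sum (fuse_first_linear_r _)) scaler_sumr.
      apply: eq_bigr => j _; rewrite (linear_functionZ (fuse_first_linear_r _)) scalerA.
      rewrite /p (linear_functionZ (e_pairing_linear_l _)) unit_coefZ.
      by rewrite e_pairing_fuse_same.
    have [n' [c' [bp']]] := irr_decomposition ssC irrP (irr W ⊗ irr Y).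
    have -> : y = \sum_m fuse_first (bp_inj bp' m)
                   ((bp_proj bp' m ⊗ₘ idm _) ∘ assoc_inv _ _ _ ∘ y).
      rewrite -[LHS]comp1m -(assocVK (irr W)) -(compm1 (assoc _ _ _)) -tensm_id -(bp_sum bp').
      rewrite tens_suml comp_sumr !comp_suml; apply: eq_bigr => m _.
      by rewrite tens_compl /fuse_first !compA.
    rewrite (linear_function_sum Qlin); apply: eq_bigr => m _.
    by rewrite Qfuse.
rewrite (sum_tagged (fun m k => transfer (v m k) (v' m k))).
apply: eq_bigr => m _; apply: eq_bigr => k _.
by rewrite transfer_slide compA -tens_compr bp_projK tensm_id comp1m.
Qed.

(** In each component, inserting the decomposition of A between e Y and e Z gives the
    left side of [transfer_tensor], with sq V ^+ 2 as the weight of V; grouping the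
    right side by isomorphism class gives the multiplicities. *)
Lemma fusion_rule (sq : Irr -> K) (sqE : forall X, sq X ^+ 2 = sdim (irr X))
    (A : C) (B : biproduct (fun X => irr X ⊗ dual (irr X)) A) (e : Irr -> hom A A)
    (eE : forall Y X Z,
       bp_proj B Z ∘ e Y ∘ bp_inj B X = (sdim (irr Y) * sq X * sq Z) *: component Y X Z) Y Z :
  e Y ∘ e Z
  = \sum_X (sdim (irr Y) * sdim (irr Z) / sdim (irr X)
            * (fusion_coef (irr X) (irr Y) (irr Z))%:R) *: e X.
Proof.
have [n [c [bp]]] := irr_decomposition ssC irrP (irr Y ⊗ irr Z).
apply: (biproduct_ext (a := B) (b := B)) => X W.
transitivity ((sdim (irr Y) * sdim (irr Z) * sq X * sq W) *: \sum_m component (c m) X W).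
  rewrite -(transfer_tensor X W bp) -[e Y]compm1 -(bp_sum B).
  rewrite comp_sumr comp_suml comp_sumr comp_suml scaler_sumr.
  apply: eq_bigr => V _; rewrite !compA eE -!compA (compA _ (e Z)) eE compZl compZr !scalerA.
  by rewrite -(sqE V); congr (_ *: _); ring.
rewrite (partition_big c xpredT) //= comp_sumr comp_suml scaler_sumr.
apply: eq_bigr => U _.
rewrite (eq_bigr (fun=> component U X W)) => [|m /eqP -> //].
rewrite sumr_const compZr compZl eE scalerA -scaler_nat scalerA.
rewrite /fusion_coef (multiplicity abC irrP bp); congr (_ *: _).
by field; apply: sdim_irr_neq0.
Qed.

End FusionRule.

Theorem proposition3p3 (R : realType) (C : sphericalFusionCat R[i])
  (Irr : finType) (irr : Irr -> C) (irrP : simple_representatives irr)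
  (sq : Irr -> R[i]) (sqE : forall X : Irr, sq X ^+ 2 = sdim (irr X))
  (I : functor (base_category C) (center C))
  (I_adjoint : adjoint I (forget C) \/ adjoint (forget C) I)
  (B : biproduct (fun X : Irr => irr X ⊗ dual (irr X)) (induced_unit I))
  (hbE : forall (W : C) (Y Z : Irr),
     is_hb_component sq
       ((idm W ⊗ₘ bp_proj B Z) ∘ hb (induced_unit I) W ∘ (bp_inj B Y ⊗ₘ idm W)))
  (e : Irr -> center_hom (induced_unit I) (induced_unit I))
  (eE : forall Y X Z : Irr,
     is_e_component sq Y (bp_proj B Z ∘ center_val (e Y) ∘ bp_inj B X)) :
  forall Y Z : Irr,
    center_comp (e Y) (e Z)
    = \sum_(X : Irr)
        (sdim (irr Y) * sdim (irr Z) / sdim (irr X)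
         * (fusion_coef (irr X) (irr Y) (irr Z))%:R) *: e X.
Proof.
have bases X Y Z : {n : nat & {b : n.-tuple (hom (irr Y ⊗ dual (irr X)) (dual (irr Z)))
    & {b' : n.-tuple (hom (irr X) (irr Z ⊗ irr Y)) |
      dual_bases (@e_pairing _ C (irr X) (irr Y) (irr Z)) b b' /\
      bp_proj B Z ∘ center_val (e Y) ∘ bp_inj B X
      = (sdim (irr Y) * sq X * sq Z) *: \sum_(k < n) e_term (tnth b k) (tnth b' k)}}}.
  by have /cid[n /cid[b /cid[b' bb']]] := eE Y X Z; exists n, b, b'.
have copairing X Y Z := dual_bases_copairing
  (@e_pairing_linear_l _ C (irr X) (irr Y) (irr Z))
  (@e_pairing_linear_r _ C (irr X) (irr Y) (irr Z))
  (svalP (projT2 (projT2 (bases X Y Z)))).1.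
move=> Y Z; apply: center_val_inj.
rewrite /= (fusion_rule irrP (fun X Y Z => (copairing X Y Z).1)
  (fun X Y Z => (copairing X Y Z).2) sqE (B := B) (e := fun X => center_val (e X))).
  have val_lin : linear (@center_val _ _ (induced_unit I) (induced_unit I)) by [].
  rewrite (linear_function_sum val_lin); apply: eq_bigr => X _.
  by rewrite (linear_functionZ val_lin).
move=> Y1 X1 Z1; exact: (svalP (projT2 (projT2 (bases X1 Y1 Z1)))).2.
Qed.
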